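(* Let $o\in J$, and write $J_E=\{j_1,\dots,j_t\}$ for the index set of RAM-efficient DMUs, with $j_{t+1}$ one additional index. Consider the linear program in the variables $\lambda_{j_k},\mu_{j_k}$ $(k=1,\dots,t+1)$, $s_i^-$ $(i=1,\dots,m)$, $s_r^+$ $(r=1,\dots,s)$: $$\max\ \sum_{j\in J_E}\mu_j+\mu_{j_{t+1}}$$ subject to $$\sum_{j\in J_E}(\lambda_j+\mu_j)x_{ij}+s_i^--(\lambda_{j_{t+1}}+\mu_{j_{t+1}})x_{io}=0,\quad i=1,\dots,m,$$ $$\sum_{j\in J_E}(\lambda_j+\mu_j)y_{rj}-s_r^+-(\lambda_{j_{t+1}}+\mu_{j_{t+1}})y_{ro}=0,\quad r=1,\dots,s,$$ $$\sum_{j\in J_E}(\lambda_j+\mu_j)-(\lambda_{j_{t+1}}+\mu_{j_{t+1}})=0,$$ $$\sum_{i=1}^m\frac{s_i^-}{R_i^-}+\sum_{r=1}^s\frac{s_r^+}{R_r^+}-(\lambda_{j_{t+1}}+\mu_{j_{t+1}})(m+s)(1-\rho_o)=0,$$ $$0\le\mu_{j_k}\le1,\ \lambda_{j_k}\ge0\ (k=1,\dots,t+1),\qquad s_i^-\ge0,\ s_r^+\ge0\ \ \forall i,r.$$ Let $(\lambda_{j_k}^*,\mu_{j_k}^*,s_i^{-*},s_r^{+*})$ be an optimal solution of this program, and put $$\lambda_{j_k}'=\frac{\lambda_{j_k}^*+\mu_{j_k}^*}{\lambda_{j_{t+1}}^*+\mu_{j_{t+1}}^*}\ (k=1,\dots,t),\quad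 s_i^{-\prime}=\frac{s_i^{-*}}{\lambda_{j_{t+1}}^*+\mu_{j_{t+1}}^*},\quad s_r^{+\prime}=\frac{s_r^{+*}}{\lambda_{j_{t+1}}^*+\mu_{j_{t+1}}^*}.$$ Then $(\boldsymbol{\lambda}',\mathbf{s}^{-\prime},\mathbf{s}^{+\prime})\in\Omega_o$, and $\boldsymbol{\lambda}'$ has the maximum number of positive components among all $\boldsymbol{\lambda}$ with $(\boldsymbol{\lambda},\mathbf{s}^-,\mathbf{s}^+)\in\Omega_o$. Consequently $$R_o^G=\{\mathrm{DMU}_j \mid j\in J_E,\ \lambda_j'>0\},$$ and the associated projection $$P_o^*=(\mathbf{x}_o-\mathbf{s}^{-\prime},\ \mathbf{y}_o+\mathbf{s}^{+\prime})=\sum_{j\in J_o^G}\lambda_j'(\mathbf{x}_j,\mathbf{y}_j),$$ where $J_o^G$ is the index set of the DMUs in $R_o^G$, is a relative interior point of the minimum face $\Gamma_o^{\min}$.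
   Context: Setting. There are $n$ observed decision making units $\mathrm{DMU}_j$, $j\in J=\{1,\dots,n\}$, with input vectors $\mathbf{x}_j=(x_{1j},\dots,x_{mj})^T\in\mathbb{R}^m_{\ge 0}$ and output vectors $\mathbf{y}_j=(y_{1j},\dots,y_{sj})^T\in\mathbb{R}^s_{\ge 0}$. The technology set is $$T=\Big\{(\mathbf{x},\mathbf{y})\in\mathbb{R}^{m+s}_{\ge 0} \,\Big|\, \sum_{j\in J}\lambda_j\mathbf{x}_j\le\mathbf{x},\ \sum_{j\in J}\lambda_j\mathbf{y}_j\ge\mathbf{y},\ \sum_{j\in J}\lambda_j=1,\ \lambda_j\ge 0\ \forall j\in J\Big\}.$$ RAM model. Let $R_i^-=\max_{j\in J} x_{ij}-\min_{j\in J}x_{ij}$ and $R_r^+=\max_{j\in J} y_{rj}-\min_{j\in J}y_{rj}$ (all nonzero, so that the model below is defined). For $o\in J$, the RAM model of $\mathrm{DMU}_o$ is $$\rho_o=\min\ 1-\frac{1}{m+s}\Big\{\sum_{i=1}^m\frac{s_i^-}{R_i^-}+\sum_{r=1}^s\frac{s_r^+}{R_r^+}\Big\}$$ subject to $\sum_{j\in J}\lambda_jx_{ij}+s_i^-=x_{io}$ $(i=1,\dots,m)$, $\sum_{j\in J}\lambda_jy_{rj}-s_r^+=y_{ro}$ $(r=1,\dots,s)$, $\sum_{j\in J}\lambda_j=1$, $\lambda_j\ge0$, $s_i^-\ge0$, $s_r^+\ge0$. $\mathrm{DMU}_o$ is RAM-efficient iff $\rho_o=1$; $J_E\subseteq J$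 is the index set of all RAM-efficient DMUs. The set of all optimal solutions of the RAM model of $\mathrm{DMU}_o$ is written (with $\lambda_j=0$ for $j\notin J_E$ omitted) as the set $\Omega_o$ of all $(\boldsymbol{\lambda},\mathbf{s}^-,\mathbf{s}^+)$, $\boldsymbol{\lambda}=(\lambda_j)_{j\in J_E}$, such that $\sum_{j\in J_E}\lambda_jx_{ij}+s_i^-=x_{io}$ for all $i$, $\sum_{j\in J_E}\lambda_jy_{rj}-s_r^+=y_{ro}$ for all $r$, $\sum_{j\in J_E}\lambda_j=1$, $\sum_{i=1}^m s_i^-/R_i^-+\sum_{r=1}^s s_r^+/R_r^+=(m+s)(1-\rho_o)$, and all variables are $\ge0$. Projections. For an optimal solution $(\boldsymbol{\lambda}^*,\mathbf{s}^{-*},\mathbf{s}^{+*})$ of the RAM model of $\mathrm{DMU}_o$, the associated projection is $P=(\mathbf{x}_o-\mathbf{s}^{-*},\mathbf{y}_o+\mathbf{s}^{+*})$. The projection set is $\Lambda_o=\{(\mathbf{x}_o-\mathbf{s}^-,\mathbf{y}_o+\mathbf{s}^+)\mid(\boldsymbol{\lambda},\mathbf{s}^-,\mathbf{s}^+)\in\Omega_o\}$. Reference sets. For $P\in\Lambda_o$, the maximal reference set is $R_{oP}^M=\{\mathrm{DMU}_j \mid \lambda_j^*>0$ in some optimal solution of the RAM model of $\mathrm{DMU}_o$ associated with $P\}$. The global reference set (GRS) of $\mathrm{DMU}_o$ is $R_o^G=\bigcup_{P\in\Lambda_o}R_{oP}^M$. Faces. A face of $T$ is a set $F=H\cap T$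 where $H$ is a supporting hyperplane of $T$. The minimum face of $\mathrm{DMU}_o$ is $\Gamma_o^{\min}=\bigcap\{F \mid F\text{ is a face of }T\text{ and }\Lambda_o\subseteq F\}$. *)

(* Defs.v *)
From HB Require Import structures.
From mathcomp Require Import all_boot all_order all_algebra.
From mathcomp Require Import all_classical all_reals all_analysis.

Set Implicit Arguments.
Unset Strict Implicit.
Unset Printing Implicit Defensive.

Import Order.TTheory GRing.Theory Num.Theory.
Import numFieldNormedType.Exports.

Local Open Scope classical_set_scope.
Local Open Scope ring_scope.

Section Geometry.
Context {R : realType} {d : nat}.
Implicit Types (S H F : set 'cV[R]_d) (z : 'cV[R]_d).

Definition dotv (a z : 'cV[R]_d) : R := \sum_i a i 0 * z i 0.

(* The inequality has a fixed direction; (a, b) may be replaced by (-a, -b). *)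
Definition supporting_hyperplane S H : Prop :=
  exists (a : 'cV[R]_d) (b : R),
    [/\ a != 0, H = [set z | dotv a z = b],
        (forall z, S z -> dotv a z <= b) & H `&` S !=set0].

Definition is_face S F : Prop :=
  exists2 H, supporting_hyperplane S H & F = H `&` S.

Definition affine_hull S : set 'cV[R]_d :=
  [set z | exists (k : nat) (p : 'I_k -> 'cV[R]_d) (a : 'I_k -> R),
     [/\ forall i, S (p i), \sum_i a i = 1 & z = \sum_i a i *: p i]].

(* The interior of S for the topology induced on its affine hull. *)
Definition relative_interior S : set 'cV[R]_d :=
  [set z | S z /\ within (affine_hull S) (nbhs z) S].

End Geometry.

Definition num_positive {R : realType} {I : finType} (f : I -> R) : nat :=
  #|[pred i | 0 < f i]|.

(* Column j of x (resp. y) is the input (resp. output) vector of DMU_j.  There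
   are n.+1 DMUs (the index set is nonempty), and DMU_j is identified with its
   index j, so DMUs with equal data remain distinct. *)
Section RAM.
Context {R : realType} {m s n : nat}.
Variables (x : 'M[R]_(m, n.+1)) (y : 'M[R]_(s, n.+1)).

Definition technology : set 'cV[R]_(m + s) :=
  [set z : 'cV[R]_(m + s) | (forall i, 0 <= z i 0) /\
     exists lam : 'I_n.+1 -> R,
       [/\ forall i, \sum_j lam j * x i j <= usubmx z i 0,
           forall r, dsubmx z r 0 <= \sum_j lam j * y r j,
           \sum_j lam j = 1 & forall j, 0 <= lam j]].

Definition row_range {p : nat} (A : 'M[R]_(p, n.+1)) (i : 'I_p) : R :=
  \big[Num.max/A i ord0]_j A i j - \big[Num.min/A i ord0]_j A i j.

Definition weighted_slack (sm : 'cV[R]_m) (sp : 'cV[R]_s) : R :=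
  \sum_i sm i 0 / row_range x i + \sum_r sp r 0 / row_range y r.

Definition ram_objective (sm : 'cV[R]_m) (sp : 'cV[R]_s) : R :=
  1 - 1 / (m + s)%:R * weighted_slack sm sp.

Definition ram_feasible (o : 'I_n.+1)
    (lam : 'I_n.+1 -> R) (sm : 'cV[R]_m) (sp : 'cV[R]_s) : Prop :=
  [/\ forall i, \sum_j lam j * x i j + sm i 0 = x i o,
      forall r, \sum_j lam j * y r j - sp r 0 = y r o,
      \sum_j lam j = 1,
      forall j, 0 <= lam j
    & (forall i, 0 <= sm i 0) /\ (forall r, 0 <= sp r 0)].

Definition ram_optimal (o : 'I_n.+1)
    (lam : 'I_n.+1 -> R) (sm : 'cV[R]_m) (sp : 'cV[R]_s) : Prop :=
  ram_feasible o lam sm sp /\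
  forall lam' sm' sp', ram_feasible o lam' sm' sp' ->
    ram_objective sm sp <= ram_objective sm' sp'.

(* The feasible set is a nonempty compact polytope, so this infimum is the
   minimum. *)
Definition rho (o : 'I_n.+1) : R :=
  inf [set v | exists lam sm sp,
                 ram_feasible o lam sm sp /\ v = ram_objective sm sp].

Definition efficient : {set 'I_n.+1} := [set j | rho j == 1]%SET.

(* The index type of the families (lambda_j)_{j in J_E}. *)
Local Notation eff_index := {j : 'I_n.+1 | j \in efficient}.

Definition Omega (o : 'I_n.+1) : set ((eff_index -> R) * 'cV[R]_m * 'cV[R]_s) :=
  [set w : (eff_index -> R) * 'cV[R]_m * 'cV[R]_s | let: (lam, sm, sp) := w in
     [/\ forall i, \sum_j lam j * x i (val j) + sm i 0 = x i o,
         forall r, \sum_j lam j * y r (val j) - sp r 0 = y r o,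
         \sum_j lam j = 1,
         weighted_slack sm sp = (m + s)%:R * (1 - rho o)
       & [/\ forall j, 0 <= lam j, forall i, 0 <= sm i 0
           & forall r, 0 <= sp r 0]]].

Definition projection (o : 'I_n.+1) (sm : 'cV[R]_m) (sp : 'cV[R]_s) :
  'cV[R]_(m + s) := col_mx (col o x - sm) (col o y + sp).

Definition projection_set (o : 'I_n.+1) : set 'cV[R]_(m + s) :=
  [set P | exists lam sm sp, Omega o (lam, sm, sp) /\ P = projection o sm sp].

Definition maximal_reference_set (o : 'I_n.+1) (P : 'cV[R]_(m + s)) :
    set 'I_n.+1 :=
  [set j | exists lam sm sp,
     [/\ ram_optimal o lam sm sp, projection o sm sp = P & 0 < lam j]].

Definition global_reference_set (o : 'I_n.+1) : set 'I_n.+1 :=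
  \bigcup_(P in projection_set o) maximal_reference_set o P.

Definition minimum_face (o : 'I_n.+1) : set 'cV[R]_(m + s) :=
  \bigcap_(F in [set F | is_face technology F /\ projection_set o `<=` F]) F.

(* In the linear program, [Some j] is an index j of J_E and [None] is the
   additional index j_{t+1}. *)
Definition lp_objective (mu : option eff_index -> R) : R :=
  \sum_(j : eff_index) mu (Some j) + mu None.

Definition lp_feasible (o : 'I_n.+1) (lam mu : option eff_index -> R)
    (sm : 'cV[R]_m) (sp : 'cV[R]_s) : Prop :=
  [/\ forall i, \sum_(j : eff_index) (lam (Some j) + mu (Some j)) * x i (val j)
        + sm i 0 - (lam None + mu None) * x i o = 0,
      forall r, \sum_(j : eff_index) (lam (Some j) + mu (Some j)) * y r (val j)
        - sp r 0 - (lam None + mu None) * y r o = 0,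
      \sum_(j : eff_index) (lam (Some j) + mu (Some j))
        - (lam None + mu None) = 0,
      weighted_slack sm sp
        - (lam None + mu None) * (m + s)%:R * (1 - rho o) = 0
    & [/\ forall k, 0 <= mu k <= 1, forall k, 0 <= lam k,
          forall i, 0 <= sm i 0 & forall r, 0 <= sp r 0]].

Definition lp_optimal (o : 'I_n.+1) (lam mu : option eff_index -> R)
    (sm : 'cV[R]_m) (sp : 'cV[R]_s) : Prop :=
  lp_feasible o lam mu sm sp /\
  forall lam' mu' sm' sp', lp_feasible o lam' mu' sm' sp' ->
    lp_objective mu' <= lp_objective mu.

End RAM.

Notation eff_index x y := {j : 'I__ | j \in efficient x y}.

Arguments Omega {R m s n} x y o _.
Arguments lp_objective {R m s n} x y mu.
Arguments lp_feasible {R m s n} x y o lam mu sm sp.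
Arguments lp_optimal {R m s n} x y o lam mu sm sp.

(* Main.v *)
Require Import Defs.
From mathcomp Require Import all_boot all_order all_algebra.
From mathcomp Require Import all_classical all_reals all_analysis.
From mathcomp Require Import ring lra.

Import Order.TTheory GRing.Theory Num.Theory.
Import numFieldNormedType.Exports.

Local Open Scope classical_set_scope.
Local Open Scope ring_scope.

(** Fourier-Motzkin elimination of the intensity variables
    ([eliminate_variables], [enveloping_system]) turns the condition that some
    lambda satisfies the constraints of the model into finitely many affine
    inequalities, jointly in the point of the input-output space and in a
    bound v on the objective.  This gives two facts: the infimum defining rho
    is attained ([rho_attained]), because the admissible v form a closed set,
    and the technology is an intersection of finitely many half-spaces
    ([technology_polyhedral]).

    An optimal lambda charges only efficient units: weight
    on an inefficient unit j could be moved to an optimal solution of the model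
    of j, with a gain ([optimal_support_efficient]).  Hence Omega is, up to
    extension of lambda by zero, the set of optimal solutions
    ([Omega_optimal]), and it is not empty.

    The constraints of the linear program are those of the cone over Omega,
    written for the sums lambda + mu, and the optimum pushes mu up to
    min (1, lambda + mu).  If lambda + mu vanishes at an index k where some
    element of the cone is positive, adding the multiple of that element with
    k-th entry 1 and putting this entry in mu raises the objective by 1
    ([lp_support]).  So the support of an optimal lambda + mu contains the
    support of every element of the cone.  The additional index shows that the
    divisor is positive, and the other indices show that the support of lambda'
    contains that of every member of Omega; the cardinality claim and the
    description of the global reference set follow.

    P is a combination with positive weights of all the
    units that occur in any projection.  A face through P therefore contains
    all these units, and with them the whole projection set
    ([face_through_projection]), so the minimum face is the intersection of all
    faces through P.  For a polyhedron, P is a relative interior point of that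
    intersection ([relint_faces_through_point]). *)

(** * Elimination of variables from linear inequalities *)

Lemma sum_pick {R : realType} {I : finType} (k : I) (f : I -> R) :
  \sum_i (i == k)%:R * f i = f k.
Proof.
rewrite (bigD1 k) //= eqxx mul1r big1 ?addr0 // => i /negPf ->.
by rewrite mul0r.
Qed.

(** The weights do not depend on the free terms f.  A pair (i, j) encodes
    either the inequality i, if t does not occur in it, or the combination of a
    lower bound i and an upper bound j on t that cancels t, or 0 <= 0. *)
Lemma eliminate_variable {R : realType} {I : finType} (c : I -> R) :
  exists W : I * I -> I -> R, forall f : I -> R,
    (exists t, forall i, f i + c i * t <= 0) <->
    (forall p, \sum_i W p i * f i <= 0).
Proof.
pose W (p : I * I) (i : I) : R :=
  if c p.1 == 0 then (i == p.1)%:R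
  else if (c p.1 < 0) && (0 < c p.2)
  then c p.2 * (i == p.1)%:R - c p.1 * (i == p.2)%:R else 0.
have WE f p : \sum_i W p i * f i =
  if c p.1 == 0 then f p.1
  else if (c p.1 < 0) && (0 < c p.2)
  then c p.2 * f p.1 - c p.1 * f p.2 else 0.
  rewrite /W; case: ifP => _; first exact: sum_pick.
  case: ifP => _; last by rewrite big1 // => i _; rewrite mul0r.
  rewrite -(sum_pick p.1 f) -(sum_pick p.2 f) !mulr_sumr -sumrB.
  by apply: eq_bigr => i _; rewrite mulrBl !mulrA.
exists W => f; split=> [[t ft] [i j]|Wf].
  rewrite WE /=; case: eqP => [ci0|_].
    by move: (ft i); rewrite ci0 mul0r addr0.
  case: andP => [[ci cj]|_] //.
  have := ft i; have := ft j; nra.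
have f0 i : c i = 0 -> f i <= 0.
  by move=> ci; move: (Wf (i, i)); rewrite WE /= ci eqxx.
have fP i j : c i < 0 -> 0 < c j -> c j * f i - c i * f j <= 0.
  by move=> ci cj; move: (Wf (i, j)); rewrite WE /= (lt_eqF ci) ci cj.
(* The largest lower bound on t is a witness. *)
case: (pickP (fun i => c i < 0)) => [i0 ci0|noneg].
  case: (@arg_maxP _ _ _ i0 (fun i => c i < 0) (fun i => - f i / c i) ci0)
    => i ci imax.
  exists (- f i / c i) => j; case: (ltgtP (c j) 0) => cj.
  - have := imax j cj; rewrite /= => le_ji.
    have -> : f j = - c j * (- f j / c j) by field; rewrite lt_eqF.
    nra.
  - have -> : f j + c j * (- f i / c i) = (c j * f i - c i * f j) / - c i.
      by field; rewrite lt_eqF.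
    by rewrite mulr_le0_ge0 ?fP // invr_ge0 oppr_ge0 ltW.
  - by rewrite cj mul0r addr0 f0.
(* Without a lower bound, the smallest upper bound is a witness. *)
case: (pickP (fun i => 0 < c i)) => [i0 ci0|nopos].
  case: (@arg_minP _ _ _ i0 (fun i => 0 < c i) (fun i => - f i / c i) ci0)
    => i ci imin.
  exists (- f i / c i) => j; case: (ltgtP (c j) 0) => cj.
  - by move: (noneg j); rewrite cj.
  - have := imin j cj; rewrite /= => le_ij.
    have -> : f j = - c j * (- f j / c j) by field; rewrite gt_eqF.
    nra.
  - by rewrite cj mul0r addr0 f0.
exists 0 => j; rewrite mulr0 addr0; apply: f0.
by apply/eqP; rewrite eq_le !leNgt noneg nopos.
Qed.

(** The free terms g stay arbitrary, so that the same weights serve for every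
    value of the parameters on which g depends. *)
Lemma eliminate_variables {R : realType} (k : nat) (I : finType)
    (C : I -> 'I_k -> R) :
  exists (J : finType) (W : J -> I -> R), forall g : I -> R,
    (exists t : 'I_k -> R, forall i, g i + \sum_l C i l * t l <= 0) <->
    (forall j, \sum_i W j i * g i <= 0).
Proof.
elim: k I C => [|k IHk] I C.
  exists I, (fun j i => (i == j)%:R) => g; split=> [[t gt] j|gle0].
    by rewrite sum_pick; move: (gt j); rewrite big_ord0 addr0.
  by exists (fun=> 0) => i; rewrite big_ord0 addr0 -(sum_pick i).
have [V VP] := eliminate_variable (fun i => C i ord0).
have [J [W WP]] :=
  IHk _ (fun p l => \sum_i V p i * C i (lift ord0 l)).
exists J, (fun j i => \sum_p W j p * V p i) => g.
have VE (t : 'I_k -> R) p :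
    \sum_i V p i * (g i + \sum_l C i (lift ord0 l) * t l) =
    \sum_i V p i * g i + \sum_l (\sum_i V p i * C i (lift ord0 l)) * t l.
  transitivity (\sum_i (V p i * g i + \sum_l V p i * C i (lift ord0 l) * t l)).
    apply: eq_bigr => i _; rewrite mulrDr mulr_sumr.
    by congr (_ + _); apply: eq_bigr => l _; rewrite mulrA.
  rewrite big_split exchange_big; congr (_ + _).
  by apply: eq_bigr => l _; rewrite mulr_suml.
have WE j : \sum_i (\sum_p W j p * V p i) * g i =
            \sum_p W j p * \sum_i V p i * g i.
  under eq_bigr do rewrite mulr_suml.
  rewrite exchange_big; apply: eq_bigr => p _; rewrite mulr_sumr.
  by apply: eq_bigr => i _; rewrite mulrA.
split=> [[t gt] j|Wg].
  rewrite WE; move: j; apply/WP; exists (fun l => t (lift ord0 l)) => p.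
  rewrite -VE; move: p; apply/VP; exists (t ord0) => i.
  by have := gt i; rewrite big_ord_recl; lra.
have /WP[t gt] : forall j, \sum_p W j p * (\sum_i V p i * g i) <= 0.
  by move=> j; rewrite -WE.
have /VP[t0 gt0] : forall p,
    \sum_i V p i * (g i + \sum_l C i (lift ord0 l) * t l) <= 0.
  by move=> p; rewrite VE.
exists (fun l => oapp t t0 (unlift ord0 l)) => i.
rewrite big_ord_recl unlift_none /=.
under eq_bigr do rewrite liftK /=.
by have := gt0 i; lra.
Qed.

(** * Faces of a polyhedron through a given point *)

Section Dotv.
Context {R : realType} {d : nat}.
Implicit Types (a z : 'cV[R]_d).

Lemma dotv_suml {I : finType} (c : I -> R) (p : I -> 'cV[R]_d) z :
  dotv (\sum_i c i *: p i) z = \sum_i c i * dotv (p i) z.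
Proof.
rewrite /dotv; under [RHS]eq_bigr do rewrite mulr_sumr.
rewrite exchange_big; apply: eq_bigr => k _.
by rewrite summxE mulr_suml; apply: eq_bigr => i _; rewrite mxE mulrA.
Qed.

Lemma dotvC a z : dotv a z = dotv z a.
Proof. by apply: eq_bigr => k _; rewrite mulrC. Qed.

Lemma dotv_sumr {I : finType} (c : I -> R) (p : I -> 'cV[R]_d) a :
  dotv a (\sum_i c i *: p i) = \sum_i c i * dotv a (p i).
Proof.
by rewrite dotvC dotv_suml; apply: eq_bigr => i _; rewrite dotvC.
Qed.

Lemma dotv_delta (k : 'I_d) z : dotv (delta_mx k 0) z = z k 0.
Proof.
rewrite -(sum_pick k (fun i => z i 0)); apply: eq_bigr => i _.
by rewrite mxE eqxx andbT.
Qed.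

Lemma dotvNl a z : dotv (- a) z = - dotv a z.
Proof. by rewrite -sumrN; apply: eq_bigr => i _; rewrite mxE mulNr. Qed.

Lemma dot0v z : dotv 0 z = 0.
Proof. by apply: big1 => i _; rewrite mxE mul0r. Qed.

Lemma dotv_reflect a p z : dotv a (p + (p - z)) = 2 * dotv a p - dotv a z.
Proof.
rewrite /dotv mulr_sumr -sumrB; apply: eq_bigr => i _; rewrite !mxE; ring.
Qed.

Lemma dotv_continuous a : continuous (dotv a).
Proof.
apply: continuous_big => [|i _]; first exact: add_continuous.
move=> z; exact: (cvgM (cvg_cst (a i 0)) (@coord_continuous R d 1 i 0 z)).
Qed.

(** An inequality that is tight at p, with nonzero normal, cuts out a face
    through p, so it remains an equality on the affine hull of the
    intersection.  The inequalities that are slack at p hold near p, both for z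
    and for its reflection 2 p - z.  Hence near p both points of the affine
    hull lie in S, and a supporting hyperplane through their midpoint p has to
    contain z. *)
Lemma relint_faces_through_point (S : set 'cV[R]_d) (J : finType)
    (a : J -> 'cV[R]_d) (b : J -> R) (p : 'cV[R]_d) :
  (forall z, S z <-> forall j, dotv (a j) z <= b j) -> S p ->
  relative_interior (\bigcap_(F in [set F | is_face S F /\ F p]) F) p.
Proof.
move=> SE Sp; split; first by move=> F [].
have near_inactive : \forall z \near p, forall j, dotv (a j) p < b j ->
    dotv (a j) z <= b j /\ dotv (a j) (p + (p - z)) <= b j.
  apply: (@filter_forall _ J (fun j z => dotv (a j) p < b j ->
    dotv (a j) z <= b j /\ dotv (a j) (p + (p - z)) <= b j) (nbhs p) _) => j.
  case: (ltP (dotv (a j) p) (b j)) => [ltb|_]; last exact: nearW.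
  have cv := dotv_continuous (a j) p.
  have h1 : \forall z \near p, dotv (a j) z <= b j by exact: cvgr_le cv _ ltb.
  have h2 : \forall z \near p, 2 * dotv (a j) p - b j <= dotv (a j) z.
    by apply: cvgr_ge cv _ _; lra.
  near=> z => _; split; first by near: z.
  rewrite dotv_reflect.
  have : 2 * dotv (a j) p - b j <= dotv (a j) z by near: z.
  lra.
apply: filterS near_inactive => z inactive [k [q [t [qG t1 zE]]]].
have active j : dotv (a j) p = b j -> dotv (a j) z = b j.
  move=> pj; have [aj0|ajN0] := eqVneq (a j) 0.
    by rewrite -pj aj0 !dot0v.
  (* An affine combination of points of the face defined by j. *)
  rewrite zE dotv_sumr -[RHS]mul1r -t1 mulr_suml; apply: eq_bigr => i _.
  congr (_ * _).
  have [] : ([set w | dotv (a j) w = b j] `&` S) (q i).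
    apply: qG; split => //; exists [set w | dotv (a j) w = b j] => //.
    exists (a j), (b j); split => // [w /SE|]; first exact.
    by exists p.
  by [].
have ineq w : (forall j, dotv (a j) p < b j -> dotv (a j) w <= b j) ->
    (forall j, dotv (a j) p = b j -> dotv (a j) w = b j) -> S w.
  move=> wi wa; apply/SE => j.
  have := (SE p).1 Sp j; rewrite le_eqVlt => /orP[/eqP /wa ->|/wi] //.
have Sz : S z by apply: ineq => // j /inactive[].
have Sz' : S (p + (p - z)).
  apply: ineq => [j /inactive[] //|j pj].
  by rewrite dotv_reflect (active j pj) pj; ring.
move=> F [[H [e [c [e0 HE Sc _]] FE]] Fp].
rewrite FE HE; split => //=.
move: Fp; rewrite FE HE => -[/= pc _].
have := Sc _ Sz; have := Sc _ Sz'; rewrite dotv_reflect pc; lra.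
Unshelve. all: by end_near.
Qed.

End Dotv.

(** * The technology as a polyhedron *)

Section Technology.
Context {R : realType} {m s n : nat}.
Variables (x : 'M[R]_(m, n.+1)) (y : 'M[R]_(s, n.+1)).

(** The constraints on the intensities, shared by the technology and by the
    RAM model once the slacks are eliminated. *)
Definition enveloping (z : 'cV[R]_(m + s)) (lam : 'I_n.+1 -> R) : Prop :=
  [/\ forall i, \sum_j lam j * x i j <= usubmx z i 0,
      forall r, dsubmx z r 0 <= \sum_j lam j * y r j,
      \sum_j lam j = 1 & forall j, 0 <= lam j].

(** The bound v on a linear cost is kept as a parameter: c = 0 describes the
    technology, and the RAM objective as cost describes the attainable
    objective values. *)
Lemma enveloping_system (c : 'I_n.+1 -> R) :
  exists (J : finType) (a : J -> 'cV[R]_(m + s)) (b e : J -> R),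
  forall z v, (exists2 lam, enveloping z lam & \sum_j lam j * c j <= v) <->
    forall j, dotv (a j) z <= b j + e j * v.
Proof.
(* One row per constraint; the rows indexed by bool are the two inequalities
   of sum lam = 1, and the row indexed by unit is the bound on the cost. *)
pose C (k : 'I_m + 'I_s + bool + 'I_n.+1 + unit) (j : 'I_n.+1) : R :=
  match k with
  | inl (inl (inl (inl i))) => x i j
  | inl (inl (inl (inr r))) => - y r j
  | inl (inl (inr sg)) => (-1) ^+ sg
  | inl (inr j') => - (j == j')%:R
  | inr tt => c j
  end.
pose A (k : 'I_m + 'I_s + bool + 'I_n.+1 + unit) : 'cV[R]_(m + s) :=
  match k with
  | inl (inl (inl (inl i))) => - delta_mx (lshift s i) 0
  | inl (inl (inl (inr r))) => delta_mx (rshift m r) 0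
  | _ => 0
  end.
pose B (k : 'I_m + 'I_s + bool + 'I_n.+1 + unit) : R :=
  if k is inl (inl (inr sg)) then (-1) ^+ sg else 0.
pose E (k : 'I_m + 'I_s + bool + 'I_n.+1 + unit) : R :=
  if k is inr tt then 1 else 0.
have [J [W WP]] := @eliminate_variables _ _ _ C.
exists J, (fun j => \sum_k W j k *: A k), (fun j => \sum_k W j k * B k),
  (fun j => \sum_k W j k * E k) => z v.
pose g k := dotv (A k) z - B k - E k * v.
have -> : (forall j, dotv (\sum_k W j k *: A k) z <=
             \sum_k W j k * B k + (\sum_k W j k * E k) * v) <->
          (forall j, \sum_k W j k * g k <= 0).
  have gE j : \sum_k W j k * g k = dotv (\sum_k W j k *: A k) z -
      \sum_k W j k * B k - (\sum_k W j k * E k) * v.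
    rewrite dotv_suml mulr_suml -!sumrB; apply: eq_bigr => k _.
    by rewrite /g; ring.
  by split=> h j; have := h j; rewrite gE; lra.
rewrite -WP; split=> [[lam [hx hy h1 h0] hv]|[lam h]].
  exists lam => -[[[[i|r]|sg]|j]|[]]; rewrite /g /=.
  - rewrite dotvNl dotv_delta subr0 mul0r subr0.
    have := hx i; rewrite mxE; under eq_bigr do rewrite mulrC.
    lra.
  - rewrite dotv_delta subr0 mul0r subr0.
    have := hy r; rewrite mxE.
    under [in X in _ -> X]eq_bigr do rewrite mulNr mulrC.
    by rewrite sumrN; lra.
  - by rewrite dot0v mul0r subr0 -mulr_sumr h1 mulr1 sub0r addNr.
  - rewrite dot0v mul0r !subr0 add0r.
    under eq_bigr do rewrite mulNr.
    by rewrite sumrN sum_pick oppr_le0.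
  - rewrite dot0v subr0 mul1r; under eq_bigr do rewrite mulrC.
    by lra.
have h1 : \sum_j lam j = 1.
  have := h (inl (inl (inr true))); have := h (inl (inl (inr false))).
  by rewrite /g /= !dot0v !mul0r -!mulr_sumr; lra.
exists lam; first split=> //.
- move=> i; have := h (inl (inl (inl (inl i)))).
  rewrite /g /= dotvNl dotv_delta mxE.
  by under eq_bigr do rewrite mulrC; lra.
- move=> r; have := h (inl (inl (inl (inr r)))).
  rewrite /g /= dotv_delta mxE.
  by under eq_bigr do rewrite mulNr mulrC; rewrite sumrN; lra.
- move=> j; have := h (inl (inr j)); rewrite /g /= dot0v.
  under eq_bigr do rewrite mulNr.
  by rewrite sumrN sum_pick; lra.
have := h (inr tt); rewrite /g /= dot0v.
by under eq_bigr do rewrite mulrC; lra.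
Qed.

Lemma technology_polyhedral :
  exists (J : finType) (a : J -> 'cV[R]_(m + s)) (b : J -> R),
  forall z, technology x y z <-> forall j, dotv (a j) z <= b j.
Proof.
have [J [a [b [e h]]]] := enveloping_system (fun=> 0).
exists (J + 'I_(m + s))%type, (fun k => match k with
  | inl j => a j | inr i => - delta_mx i 0 end),
  (fun k => if k is inl j then b j else 0) => z.
have {}h : (exists lam, enveloping z lam) <-> forall j, dotv (a j) z <= b j.
  have -> : (forall j, dotv (a j) z <= b j) <->
            (forall j, dotv (a j) z <= b j + e j * 0).
    by split=> hj j; have := hj j; rewrite mulr0 addr0.
  rewrite -h; split=> [[lam el]|[lam el _]]; exists lam => //.
  by rewrite big1 // => j _; rewrite mulr0.
split=> [[z0 /h za] [j|i]|hz]; first exact: za.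
  by rewrite dotvNl dotv_delta oppr_le0.
split=> [i|]; last by apply/h => j; have := hz (inl j).
by have := hz (inr i); rewrite dotvNl dotv_delta oppr_le0.
Qed.

End Technology.

(** * Optimal solutions of the RAM model *)

Section Ram.
Set Implicit Arguments.
Unset Strict Implicit.
Context {R : realType} {m s n : nat}.
Variables (x : 'M[R]_(m, n.+1)) (y : 'M[R]_(s, n.+1)).
Local Notation DMU j := (col_mx (col j x) (col j y)).

Lemma weighted_slack_sum {I : finType} (c : I -> R)
    (u : I -> 'cV[R]_m) (v : I -> 'cV[R]_s) :
  weighted_slack x y (\sum_k c k *: u k) (\sum_k c k *: v k) =
  \sum_k c k * weighted_slack x y (u k) (v k).
Proof.
rewrite /weighted_slack; under [RHS]eq_bigr do rewrite mulrDr !mulr_sumr.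
rewrite big_split /=.
congr (_ + _); rewrite exchange_big; apply: eq_bigr => i _.
  by rewrite summxE mulr_suml; apply: eq_bigr => k _; rewrite mxE mulrA.
by rewrite summxE mulr_suml; apply: eq_bigr => k _; rewrite mxE mulrA.
Qed.

Lemma weighted_slackDZ t (u u' : 'cV[R]_m) (v v' : 'cV[R]_s) :
  weighted_slack x y (u + t *: u') (v + t *: v') =
  weighted_slack x y u v + t * weighted_slack x y u' v'.
Proof.
rewrite /weighted_slack mulrDr !mulr_sumr addrACA -!big_split /=.
by congr (_ + _); apply: eq_bigr => i _; rewrite !mxE; ring.
Qed.

Lemma ram_objective_sum {I : finType} (c : I -> R)
    (u : I -> 'cV[R]_m) (v : I -> 'cV[R]_s) :
  \sum_k c k = 1 ->
  ram_objective x y (\sum_k c k *: u k) (\sum_k c k *: v k) =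
  \sum_k c k * ram_objective x y (u k) (v k).
Proof.
move=> c1; rewrite /ram_objective weighted_slack_sum mulr_sumr -{1}c1 -sumrB.
by apply: eq_bigr => k _; ring.
Qed.

Lemma ram_objective0 : ram_objective x y 0 0 = 1.
Proof.
by rewrite /ram_objective /weighted_slack !big1 ?addr0 ?mulr0 ?subr0 // => i _;
  rewrite mxE mul0r.
Qed.

Section EvaluatedUnit.
Variable o : 'I_n.+1.

Lemma feasible_slack lam sm sp : ram_feasible x y o lam sm sp ->
  sm = \sum_j lam j *: (col o x - col j x) /\
  sp = \sum_j lam j *: (col j y - col o y).
Proof.
move=> [hx hy h1 _ _]; split; apply/colP => i; rewrite summxE.
  under eq_bigr do rewrite !mxE mulrBr.
  by rewrite sumrB -mulr_suml h1 mul1r -(hx i); ring.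
under eq_bigr do rewrite !mxE mulrBr.
by rewrite sumrB -mulr_suml h1 mul1r -(hy i); ring.
Qed.

Lemma enveloping_feasible lam : enveloping x y (DMU o) lam ->
  ram_feasible x y o lam (\sum_j lam j *: (col o x - col j x))
                         (\sum_j lam j *: (col j y - col o y)).
Proof.
move=> [hx hy h1 h0].
have smE i : (\sum_j lam j *: (col o x - col j x)) i 0 =
             x i o - \sum_j lam j * x i j.
  rewrite summxE; under eq_bigr do rewrite !mxE mulrBr.
  by rewrite sumrB -mulr_suml h1 mul1r.
have spE r : (\sum_j lam j *: (col j y - col o y)) r 0 =
             \sum_j lam j * y r j - y r o.
  rewrite summxE; under eq_bigr do rewrite !mxE mulrBr.
  by rewrite sumrB -mulr_suml h1 mul1r.
split=> // [i|r|]; rewrite ?smE ?spE; [ring|ring|].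
split=> [i|r]; rewrite ?smE ?spE subr_ge0.
  by have := hx i; rewrite col_mxKu mxE.
by have := hy r; rewrite col_mxKd mxE.
Qed.

Lemma feasible_enveloping lam sm sp : ram_feasible x y o lam sm sp ->
  enveloping x y (DMU o) lam.
Proof.
move=> [hx hy h1 h0 [hm hp]]; split=> // [i|r].
  by rewrite col_mxKu mxE -(hx i) lerDl hm.
by rewrite col_mxKd mxE -(hy r) lerBlDr lerDl hp.
Qed.

Lemma self_feasible : ram_feasible x y o (fun j => (j == o)%:R) 0 0.
Proof.
split=> [i|r||j|]; first by rewrite sum_pick mxE addr0.
- by rewrite sum_pick mxE subr0.
- by under eq_bigr do rewrite -[_%:R]mulr1; rewrite sum_pick.
- exact: ler0n.
- by split=> i; rewrite mxE.
Qed.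

Let values := [set v | exists lam sm sp,
  ram_feasible x y o lam sm sp /\ v = ram_objective x y sm sp].

(* On feasible solutions the objective is linear in lambda, because the
   weights sum to 1; this is its value when lambda is concentrated in j. *)
Let cost j := ram_objective x y (col o x - col j x) (col j y - col o y).

Let feasible_cost lam sm sp : ram_feasible x y o lam sm sp ->
  ram_objective x y sm sp = \sum_j lam j * cost j.
Proof.
move=> hf; have [-> ->] := feasible_slack hf.
by case: hf => _ _ h1 _ _; rewrite ram_objective_sum.
Qed.

Let has_inf_values : has_inf values.
Proof.
split.
  exists 1; exists (fun j => (j == o)%:R), 0, 0.
  by rewrite ram_objective0; split=> //; exact: self_feasible.
case: (@arg_minP _ _ _ o xpredT cost erefl) => k _ kmin; exists (cost k).
move=> v [lam [sm [sp [hf ->]]]]; rewrite (feasible_cost hf).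
case: hf => _ _ h1 h0 _; rewrite -[leLHS]mul1r -h1 mulr_suml.
by apply: ler_sum => j _; apply: ler_wpM2l => //; exact: kmin.
Qed.

Lemma rho_le lam sm sp : ram_feasible x y o lam sm sp ->
  rho x y o <= ram_objective x y sm sp.
Proof.
move=> hf; apply: ge_inf; first by case: has_inf_values.
by exists lam, sm, sp.
Qed.

Lemma rho_le1 : rho x y o <= 1.
Proof. by rewrite -ram_objective0; exact: rho_le self_feasible. Qed.

(** The attainable values are, up to upward closure, the solutions v of
    finitely many inequalities b + e v >= const, and these inequalities pass to
    the infimum. *)
Lemma rho_attained : exists lam sm sp,
  ram_feasible x y o lam sm sp /\ ram_objective x y sm sp = rho x y o.
Proof.
have [J [a [b [e sysP]]]] := enveloping_system x y cost.
have valuesP v : values v -> forall j, dotv (a j) (DMU o) <= b j + e j * v.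
  move=> [lam [sm [sp [hf ->]]]]; apply/sysP; exists lam.
    exact: feasible_enveloping hf.
  by rewrite (feasible_cost hf).
have /sysP[lam henv hle] :
    forall j, dotv (a j) (DMU o) <= b j + e j * rho x y o.
  move=> j; rewrite leNgt; apply/negP => hlt.
  (* If e j <= 0, the inequality at the attainable value 1 implies it, because
     rho <= 1. *)
  have [ej|ej] := leP (e j) 0.
    have vo : values 1.
      exists (fun j => (j == o)%:R), 0, 0.
      by rewrite ram_objective0; split=> //; exact: self_feasible.
    by have := rho_le1; have := valuesP _ vo j; nra.
  (* Otherwise it fails on an interval above rho, which contains a value. *)
  have eps0 : 0 < (dotv (a j) (DMU o) - b j - e j * rho x y o) / e j.
    by rewrite divr_gt0 //; lra.
  have [v vV] := inf_adherent eps0 has_inf_values.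
  have := valuesP _ vV j; rewrite -/(rho x y o) -(ltr_pM2l ej) mulrDr.
  by rewrite mulrCA mulfV ?gt_eqF // mulr1; lra.
have hf := enveloping_feasible henv.
exists lam, (\sum_j lam j *: (col o x - col j x)),
  (\sum_j lam j *: (col j y - col o y)); split=> //.
by apply/eqP; rewrite eq_le (rho_le hf) andbT (feasible_cost hf).
Qed.

Lemma ram_optimalP lam sm sp : ram_optimal x y o lam sm sp <->
  ram_feasible x y o lam sm sp /\ ram_objective x y sm sp = rho x y o.
Proof.
split=> [[hf hmin]|[hf hrho]]; split=> //; last first.
  by move=> ? ? ?; rewrite hrho; exact: rho_le.
have [lam0 [sm0 [sp0 [hf0 hrho0]]]] := rho_attained.
by apply/eqP; rewrite eq_le -{1}hrho0 (hmin _ _ _ hf0) (rho_le hf).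
Qed.

End EvaluatedUnit.

(** If j were inefficient, replacing the weight of j by an optimal solution of
    the model of j would keep feasibility and lower the objective by
    lam j * (1 - rho j) > 0. *)
Lemma optimal_support_efficient o lam sm sp j :
  ram_optimal x y o lam sm sp -> 0 < lam j -> j \in efficient x y.
Proof.
move=> [[hx hy h1 h0 [hm hp]] hmin] lamj; rewrite inE; apply/negPn/negP => rhoj.
have {rhoj} rhoj : rho x y j < 1 by rewrite lt_neqAle rhoj rho_le1.
have [lam1 [sm1 [sp1 [[kx ky k1 k0 [km kp]] krho]]]] := rho_attained j.
pose lam2 k := lam k + lam j * (lam1 k - (k == j)%:R).
have sumE (f : 'I_n.+1 -> R) : \sum_k lam2 k * f k =
    \sum_k lam k * f k + lam j * (\sum_k lam1 k * f k - f j).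
  rewrite -(sum_pick j f) -sumrB mulr_sumr -big_split.
  by apply: eq_bigr => k _; rewrite /lam2 /=; ring.
have hf2 : ram_feasible x y o lam2 (sm + lam j *: sm1) (sp + lam j *: sp1).
  split=> [i|r||k|].
  - by rewrite sumE !mxE -(hx i) -(kx i); ring.
  - by rewrite sumE !mxE -(hy r) -(ky r); ring.
  - have := sumE (fun=> 1); under eq_bigr do rewrite mulr1; move=> ->.
    under eq_bigr do rewrite mulr1.
    under [in X in _ + X]eq_bigr do rewrite mulr1.
    by rewrite h1 k1 subrr mulr0 addr0.
  - rewrite /lam2; case: eqP => [->|_].
      by rewrite mulrBr mulr1 addrC subrK mulr_ge0.
    by rewrite subr0 addr_ge0 // mulr_ge0.
  - by split=> i; rewrite !mxE addr_ge0 // mulr_ge0 // ltW.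
have := hmin _ _ _ hf2.
have -> : ram_objective x y (sm + lam j *: sm1) (sp + lam j *: sp1) =
  ram_objective x y sm sp - lam j * (1 - ram_objective x y sm1 sp1).
  by rewrite /ram_objective weighted_slackDZ; ring.
by rewrite krho; nra.
Qed.

(** When m + s = 0 the slack is an empty sum and every objective value is 1, so
    that rho = 1 and both equations hold. *)
Lemma ram_objective_eq_rho o sm sp : ram_objective x y sm sp = rho x y o <->
  weighted_slack x y sm sp = (m + s)%:R * (1 - rho x y o).
Proof.
have [ms0|ms_gt0] := posnP (m + s)%N; last first.
  have ms0 : (m + s)%:R != 0 :> R by rewrite pnatr_eq0 -lt0n.
  rewrite /ram_objective; move: ((m + s)%:R : R) ms0 => N N0.
  by split=> [<-|->]; field.
have obj1 sm' sp' : ram_objective x y sm' sp' = 1.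
  by rewrite /ram_objective ms0 invr0 mulr0 mul0r subr0.
have rho1 : rho x y o = 1.
  by have [? [? [? [_ <-]]]] := rho_attained o; rewrite obj1.
rewrite obj1 rho1 subrr mulr0; split=> // _.
have [m0 s0] : m = 0%N /\ s = 0%N.
  by move/eqP: ms0; rewrite addn_eq0 => /andP[/eqP -> /eqP ->].
rewrite /weighted_slack !big1 ?addr0 // => -[i ilt] _; exfalso.
  by move: ilt; rewrite s0.
by move: ilt; rewrite m0.
Qed.

Definition extend (lam : eff_index x y -> R) (j : 'I_n.+1) : R :=
  oapp lam 0 (insub j).

Lemma extend_val lam (j : eff_index x y) : extend lam (val j) = lam j.
Proof. by rewrite /extend valK. Qed.

Lemma extend_sum {V : lmodType R} lam (D : 'I_n.+1 -> V) :
  \sum_j extend lam j *: D j = \sum_(j : eff_index x y) lam j *: D (val j).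
Proof.
rewrite (bigID (mem (efficient x y))) /= [X in _ + X]big1 => [|j jE].
  by rewrite addr0 big_sub; apply: eq_bigr => j _; rewrite extend_val.
by rewrite /extend insubF ?scale0r //; exact: negbTE.
Qed.

Lemma extend_sumM lam (f : 'I_n.+1 -> R) :
  \sum_j extend lam j * f j = \sum_(j : eff_index x y) lam j * f (val j).
Proof. exact: (@extend_sum R^o). Qed.

Lemma extend_sum1 lam :
  \sum_j extend lam j = \sum_(j : eff_index x y) lam j.
Proof.
have := extend_sumM lam (fun=> 1).
by under eq_bigr do rewrite mulr1; under [in RHS]eq_bigr do rewrite mulr1.
Qed.

Lemma Omega_optimal o lam sm sp :
  Omega x y o (lam, sm, sp) <-> ram_optimal x y o (extend lam) sm sp.
Proof.
rewrite ram_optimalP ram_objective_eq_rho; split.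
  move=> [hx hy h1 hW [h0 hm hp]]; split=> //.
  split=> // [i|r||j]; rewrite ?extend_sumM ?extend_sum1 //.
  by rewrite /extend; case: insub => //=.
move=> [[hx hy h1 h0 [hm hp]] hW]; split=> // [i|r||].
- by rewrite -(extend_sumM lam (x i)) hx.
- by rewrite -(extend_sumM lam (y r)) hy.
- by rewrite -extend_sum1.
- by split=> // j; rewrite -extend_val.
Qed.

Lemma optimal_Omega o lam sm sp : ram_optimal x y o lam sm sp ->
  Omega x y o (lam \o val, sm, sp).
Proof.
move=> hopt; apply/Omega_optimal.
suff -> : extend (lam \o val) = lam by [].
apply/funext => j; rewrite /extend; case: insubP => [u _ <- //|jE] /=.
apply/eqP; rewrite eq_sym eq_le; case: (hopt) => -[_ _ _ -> _] _.
by rewrite andbT leNgt; apply: contra jE; exact: optimal_support_efficient hopt.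
Qed.

(** Supplies the competitor that makes the divisor of the linear program
    positive. *)
Lemma Omega_nonempty o : exists lam sm sp, Omega x y o (lam, sm, sp).
Proof.
have [lam [sm [sp /ram_optimalP hopt]]] := rho_attained o.
by exists (lam \o val), sm, sp; exact: optimal_Omega.
Qed.

(** The slacks are exactly the gap between the unit and its combination of
    peers. *)
Lemma projection_sum o lam sm sp : ram_feasible x y o lam sm sp ->
  projection x y o sm sp = \sum_j lam j *: DMU j.
Proof.
move=> [hx hy _ _ _]; apply/colP => k; rewrite summxE.
case: (split_ordP k) => i ->.
  rewrite /projection col_mxEu !mxE -(hx i) addrK; apply: eq_bigr => j _.
  by rewrite mxE col_mxEu mxE.
rewrite /projection col_mxEd !mxE -(hy i) subrK; apply: eq_bigr => j _.
by rewrite mxE col_mxEd mxE.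
Qed.

Lemma Omega_projection o lam sm sp : Omega x y o (lam, sm, sp) ->
  projection x y o sm sp = \sum_(j : eff_index x y) lam j *: DMU (val j).
Proof.
by move=> /Omega_optimal[hf _]; rewrite (projection_sum hf) extend_sum.
Qed.

(** * Optimal solutions of the linear program *)

Section Program.
Variables (o : 'I_n.+1) (lam mu : option (eff_index x y) -> R).
Variables (sm : 'cV[R]_m) (sp : 'cV[R]_s).
Hypothesis lpopt : lp_optimal x y o lam mu sm sp.

(** [oapp lam0 1] is the element of the cone over Omega at height 1: the
    additional index carries the height.  Both index kinds are thus handled at
    once. *)
Lemma lp_support lam0 sm0 sp0 k : Omega x y o (lam0, sm0, sp0) ->
  0 < oapp lam0 1 k -> 0 < lam k + mu k.
Proof.
move=> [hx hy h1 hW [h0 hm hp]] lam0k.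
have [[ex ey e1 eW [mu01 lam_ge0 em ep]] hmax] := lpopt.
rewrite lt_neqAle eq_sym addr_ge0 ?andbT //; last by case/andP: (mu01 k).
apply/negP => /eqP w0.
have muk : mu k = 0.
  by have := lam_ge0 k; have /andP[] := mu01 k; lra.
have lamk : lam k = 0 by have := lam_ge0 k; lra.
(* The multiple of the competitor whose k-th entry is 1, all of it put in mu. *)
pose t := (oapp lam0 1 k)^-1.
have t0 : 0 < t by rewrite invr_gt0.
have tk : t * oapp lam0 1 k = 1 by rewrite mulVf ?gt_eqF.
pose lam1 l := lam l + t * oapp lam0 1 l - (l == k)%:R.
pose mu1 l := mu l + (l == k)%:R.
have wE l : lam1 l + mu1 l = (lam l + mu l) + t * oapp lam0 1 l.
  by rewrite /lam1 /mu1; ring.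
have sumE (f : eff_index x y -> R) :
    \sum_j (lam1 (Some j) + mu1 (Some j)) * f j =
    \sum_j (lam (Some j) + mu (Some j)) * f j + t * \sum_j lam0 j * f j.
  rewrite mulr_sumr -big_split; apply: eq_bigr => j _.
  by rewrite wE /=; ring.
have lpf : lp_feasible x y o lam1 mu1 (sm + t *: sm0) (sp + t *: sp0).
  split=> [i|r|||].
  - by rewrite sumE wE !mxE /= -(hx i); have := ex i; rewrite -(hx i); lra.
  - by rewrite sumE wE !mxE /= -(hy r); have := ey r; rewrite -(hy r); lra.
  - under eq_bigr do rewrite -[_ + _]mulr1.
    rewrite (sumE (fun=> 1)) wE /=.
    under eq_bigr do rewrite mulr1.
    under [X in _ + _ * X - _]eq_bigr do rewrite mulr1.
    by rewrite h1; lra.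
  - rewrite weighted_slackDZ wE hW /=.
    by move: eW => /eqP; rewrite subr_eq0 => /eqP ->; ring.
  split=> [l|l|i|r].
  - rewrite /mu1; case: eqP => [->|_]; last by rewrite addr0.
    by rewrite muk add0r ler01 lexx.
  - rewrite /lam1; case: eqP => [->|_]; first by rewrite lamk tk add0r subrr.
    rewrite subr0 addr_ge0 // mulr_ge0 ?(ltW t0) //.
    by case: l => [j|] /=.
  - by rewrite !mxE addr_ge0 // mulr_ge0 // ltW.
  - by rewrite !mxE addr_ge0 // mulr_ge0 // ltW.
have := hmax _ _ _ _ lpf.
suff -> : lp_objective x y mu1 = lp_objective x y mu + 1 by lra.
rewrite /lp_objective /mu1 big_split /= addrACA; congr (_ + _).
case: (k) => [j|].
  rewrite addr0; have := sum_pick j (fun=> 1 : R).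
  by under [in X in X -> _]eq_bigr do rewrite mulr1.
by rewrite big1 ?add0r.
Qed.

Let d := lam None + mu None.

Lemma lp_scale_gt0 : 0 < d.
Proof.
have [lam0 [sm0 [sp0 hO]]] := Omega_nonempty o.
by apply: (lp_support (k := None) hO); exact: ltr01.
Qed.

Let lam' (j : eff_index x y) := (lam (Some j) + mu (Some j)) / d.
Let sm' : 'cV[R]_m := \col_i (sm i 0 / d).
Let sp' : 'cV[R]_s := \col_r (sp r 0 / d).

Lemma lp_solution_Omega : Omega x y o (lam', sm', sp').
Proof.
have d0 := lp_scale_gt0; have dN0 : d != 0 by rewrite gt_eqF.
have [[ex ey e1 eW [mu01 lam_ge0 em ep]] _] := lpopt.
have sumE (f : eff_index x y -> R) : \sum_j lam' j * f j =
    (\sum_j (lam (Some j) + mu (Some j)) * f j) / d.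
  by rewrite mulr_suml; apply: eq_bigr => j _; rewrite /lam'; ring.
split=> [i|r|||].
- rewrite sumE mxE -mulrDl; apply: (mulIf dN0); rewrite divfK //.
  by have := ex i; rewrite -/d; lra.
- rewrite sumE mxE -mulrBl; apply: (mulIf dN0); rewrite divfK //.
  by have := ey r; rewrite -/d; lra.
- rewrite -mulr_suml; apply: (mulIf dN0); rewrite divfK //.
  by move: e1; rewrite -/d; lra.
- have -> : weighted_slack x y sm' sp' = weighted_slack x y sm sp / d.
    rewrite /weighted_slack mulrDl !mulr_suml.
    by congr (_ + _); apply: eq_bigr => i _; rewrite !mxE mulrAC.
  apply: (mulIf dN0); rewrite divfK //.
  by move: eW; rewrite -/d; lra.
split=> [j|i|r].
- by rewrite divr_ge0 ?(ltW d0) // addr_ge0 //; case/andP: (mu01 (Some j)).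
- by rewrite mxE divr_ge0 // ltW.
- by rewrite mxE divr_ge0 // ltW.
Qed.

Lemma lp_solution_support lam0 sm0 sp0 j :
  Omega x y o (lam0, sm0, sp0) -> 0 < lam0 j -> 0 < lam' j.
Proof.
move=> hO lam0j; rewrite divr_gt0 ?lp_scale_gt0 //.
exact: (lp_support (k := Some j) hO).
Qed.

End Program.

Lemma technology_projection o lam sm sp :
  (forall i j, 0 <= x i j) -> (forall r j, 0 <= y r j) ->
  ram_feasible x y o lam sm sp -> technology x y (projection x y o sm sp).
Proof.
move=> x_ge0 y_ge0 hf; have [hx hy h1 h0 [hm hp]] := hf.
split.
  rewrite (projection_sum hf) => k; rewrite summxE; apply: sumr_ge0 => j _.
  rewrite mxE mulr_ge0 //; case: (split_ordP k) => i ->.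
    by rewrite col_mxEu mxE.
  by rewrite col_mxEd mxE.
exists lam; split=> // [i|r].
  by rewrite col_mxKu !mxE -(hx i) addrK.
by rewrite col_mxKd !mxE -(hy r) subrK.
Qed.

Lemma technology_DMU j :
  (forall i j, 0 <= x i j) -> (forall r j, 0 <= y r j) ->
  technology x y (DMU j).
Proof.
move=> x_ge0 y_ge0.
have := technology_projection x_ge0 y_ge0 (self_feasible j).
by rewrite /projection subr0 addr0.
Qed.

(** * Solutions of maximal support and the minimum face *)

Section MaximalSolution.
Variables (o : 'I_n.+1) (lam : eff_index x y -> R).
Variables (sm : 'cV[R]_m) (sp : 'cV[R]_s).
Hypothesis lamO : Omega x y o (lam, sm, sp).
Hypothesis lam_max : forall lam0 sm0 sp0 j,
  Omega x y o (lam0, sm0, sp0) -> 0 < lam0 j -> 0 < lam j.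

Lemma global_reference_set_support :
  global_reference_set x y o = [set val j | j in [set j | 0 < lam j]].
Proof.
apply/seteqP; split=>
  [j [_ _ [lam1 [sm1 [sp1 [hopt _ lamj]]]]]|_ [j /= lamj <-]].
  have jE := optimal_support_efficient hopt lamj.
  exists (exist _ j jE) => //=.
  by apply: (lam_max (optimal_Omega hopt)).
exists (projection x y o sm sp); first by exists lam, sm, sp.
exists (extend lam), sm, sp; split=> //; last by rewrite extend_val.
exact/Omega_optimal.
Qed.

Lemma projection_reference_sum : projection x y o sm sp =
  \sum_(j : eff_index x y | val j \in global_reference_set x y o)
    lam j *: DMU (val j).
Proof.
rewrite (Omega_projection lamO) [RHS]big_mkcond; apply: eq_bigr => j _ /=.
case: ifPn => // /negP jG; suff -> : lam j = 0 by rewrite scale0r.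
apply/eqP; rewrite eq_le; case: lamO => _ _ _ _ [-> _ _]; rewrite andbT leNgt.
apply/negP => lamj; apply: jG; rewrite inE global_reference_set_support.
by exists j.
Qed.

Hypothesis x_ge0 : forall i j, 0 <= x i j.
Hypothesis y_ge0 : forall r j, 0 <= y r j.

(** A linear form bounded by b on the units reaches b at a combination only if
    it equals b at every unit of positive weight, and every projection is a
    combination of units in the support of lam. *)
Lemma face_through_projection F : is_face (technology x y) F ->
  projection_set x y o `<=` F <-> F (projection x y o sm sp).
Proof.
move=> [H [a [b [_ HE Tb _]] FE]]; split=> [|FP].
  by apply; exists lam, sm, sp.
move=> _ [lam0 [sm0 [sp0 [hO ->]]]].
have /Omega_optimal[hf0 _] := hO.
have [_ _ lam1 _ [lam_ge0 _ _]] := lamO.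
have aj j : 0 < lam j -> dotv a (DMU (val j)) = b.
  move=> lamj; apply/eqP; rewrite eq_le Tb /=; last exact: technology_DMU.
  rewrite leNgt; apply/negP => ltb.
  suff : dotv a (projection x y o sm sp) < b.
    by move: FP; rewrite FE HE => -[/= -> _]; rewrite ltxx.
  rewrite (Omega_projection lamO) dotv_sumr -[ltRHS]mul1r -lam1 mulr_suml.
  rewrite (bigD1 j) //= [ltRHS](bigD1 j) //= ltr_leD ?ltr_pM2l //.
  apply: ler_sum => k _; apply: ler_wpM2l => //.
  by apply: Tb; exact: technology_DMU.
rewrite FE HE; split=> /=; last exact: technology_projection hf0.
have [_ _ lam01 _ [lam0_ge0 _ _]] := hO.
rewrite (Omega_projection hO) dotv_sumr -[RHS]mul1r -lam01 mulr_suml.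
apply: eq_bigr => j _; have := lam0_ge0 j; rewrite le_eqVlt.
by case/orP=> [/eqP <-|/(lam_max hO)/aj ->]; rewrite ?mul0r.
Qed.

Lemma projection_relint :
  relative_interior (minimum_face x y o) (projection x y o sm sp).
Proof.
have [J [a [b TE]]] := technology_polyhedral x y.
have -> : minimum_face x y o = \bigcap_(F in [set F |
    is_face (technology x y) F /\ F (projection x y o sm sp)]) F.
  by congr (bigcap _ _); apply/seteqP; split=> F [hF] /=;
    rewrite face_through_projection.
apply: relint_faces_through_point TE _.
by have /Omega_optimal[hf _] := lamO; exact: technology_projection hf.
Qed.

End MaximalSolution.
End Ram.

Theorem mainTheorem2 (R : realType) (m s n : nat)
    (x : 'M[R]_(m, n.+1)) (y : 'M[R]_(s, n.+1))
    (x_ge0 : forall i j, 0 <= x i j) (y_ge0 : forall r j, 0 <= y r j)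
    (x_range : forall i, row_range x i != 0)
    (y_range : forall r, row_range y r != 0)
    (o : 'I_n.+1)
    (lam mu : option (eff_index x y) -> R) (sm : 'cV[R]_m) (sp : 'cV[R]_s) :
  lp_optimal x y o lam mu sm sp ->
  let d := lam None + mu None in
  let lam' := fun j : eff_index x y => (lam (Some j) + mu (Some j)) / d in
  let sm' := \col_i (sm i 0 / d) in
  let sp' := \col_r (sp r 0 / d) in
  let P := projection x y o sm' sp' in
  [/\ Omega x y o (lam', sm', sp'),
      forall lam0 sm0 sp0, Omega x y o (lam0, sm0, sp0) ->
        (num_positive lam0 <= num_positive lam')%N,
      global_reference_set x y o =
        [set val j | j in [set j : eff_index x y | 0 < lam' j]],
      P = \sum_(j : eff_index x y | val j \in global_reference_set x y o)
            lam' j *: col_mx (col (val j) x) (col (val j) y)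
    & relative_interior (minimum_face x y o) P].
Proof.
move=> lpopt d lam' sm' sp' P.
have lamO : Omega x y o (lam', sm', sp') := lp_solution_Omega lpopt.
have lam_max lam0 sm0 sp0 j :
    Omega x y o (lam0, sm0, sp0) -> 0 < lam0 j -> 0 < lam' j.
  exact: (lp_solution_support lpopt).
split=> // [lam0 sm0 sp0 hO|||].
- by apply: subset_leq_card; apply/fintype.subsetP => j; exact: lam_max hO.
- exact: global_reference_set_support lamO lam_max.
- exact: projection_reference_sum lamO lam_max.
- exact: projection_relint lamO lam_max x_ge0 y_ge0.
Qed.
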